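(* Assume: (i) (discrete Gårding inequality) there exist $\xi_h>0$ and $\alpha_h>0$ such that $\langle Av,v\rangle_X+\xi_h\langle Rv,v\rangle_Y\ge \alpha_h\|v\|_X^2$ for all $v\in V_h$, where $V_h:=\{v\in X_h: b(v,\mu)=0\ \ \forall \mu\in M_h\}$ is the discrete kernel of $b$ in $X_h$; (ii) (discrete inf-sup condition) the bilinear form $b:X_h\times M_h\to\mathbb{R}$ is bounded and there exists $\beta_h>0$ such that $\sup_{0\neq v\in X_h} b(v,q)/\|v\|_X\ge\beta_h\|q\|_M$ for all $q\in M_h$. Then the fully-discrete problem (stated in the context) has a unique solution $(u_h^n,\lambda_h^n)\in X_h\times M_h$, $n=1,\dots,N$.
   Context: $X$ and $Y$ are real Hilbert spaces, $X\subseteq Y$ with continuous and dense imbedding; $M$ is a real reflexive Banach space. $R:Y\to Y'$ and $A:X\to X'$ are bounded linear operators, $b:X\times M\to\mathbb{R}$ is a bounded bilinear form; $\langle\cdot,\cdot\rangle_Z$ denotes the duality pairing between $Z'$ and $Z$. $V:=\{v\in X: b(v,\mu)=0\ \forall\mu\in M\}$ and $W$ is the closure of $V$ in the $Y$-norm. Standing assumptions: there is $\beta>0$ with $\sup_{0\ne v\in X}b(v,\mu)/\|v\|_X\ge\beta\|\mu\|_M$ for all $\mu\in M$; $R$ is self-adjoint and monotone on $V$ ($\langle Rv,w\rangle_Y=\langle Rw,v\rangle_Y$ and $\langle Rv,v\rangle_Y\ge0$ for all $v,w\in V$); $A$ is self-adjoint on $V$ ($\langle Av,w\rangle_X=\langle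 Aw,v\rangle_X$ for all $v,w\in V$); there are $\gamma,\alpha>0$ with $\langle Av,v\rangle_X+\gamma\langle Rv,v\rangle_Y\ge\alpha\|v\|_X^2$ for all $v\in V$; the initial datum $u_0$ belongs to $W$; $g\in H^1(0,T;M')$. The source satisfies $f\in L^2(0,T;X')$ and enters the discrete problem through the values $f(t_n)$. $X_h\subset X$ and $M_h\subset M$ are finite-dimensional subspaces; $t_n:=n\Delta t$, $n=0,\dots,N$, with $\Delta t:=T/N$; $\bar\partial\theta^n:=(\theta^n-\theta^{n-1})/\Delta t$. Fully-discrete problem: given an approximation $u_{0,h}\in X_h$ of $u_0$, set $u_h^0:=u_{0,h}$, $\lambda_h^0:=0$, and find $u_h^n\in X_h$, $\lambda_h^n\in M_h$, $n=1,\dots,N$, such that $$\langle R\bar\partial u_h^n,v\rangle_Y+b(v,\bar\partial\lambda_h^n)+\langle Au_h^n,v\rangle_X=\langle f(t_n),v\rangle_X\quad\forall v\in X_h,$$ $$b(u_h^n,\mu)=\langle g(t_n),\mu\rangle_M\quad\forall\mu\in M_h.$$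
   Formalization: The claim fails for arbitrary Δt (e.g. R = 1, A = −1 on ℝ, M = {0}, Δt = 1); it is proved for all Δt ≤ τ, with τ > 0 depending only on the spaces, operators and X_h, M_h, and τ ≥ 1/ξ_h when R is monotone on V_h. *)

(* Defs.v *)
From HB Require Import structures.
From mathcomp Require Import all_boot all_order all_algebra.
From mathcomp Require Import sesquilinear.
From mathcomp Require Import all_classical all_reals all_analysis.

Set Implicit Arguments.
Unset Strict Implicit.
Unset Printing Implicit Defensive.

Import Order.TTheory GRing.Theory Num.Theory.
Import numFieldNormedType.Exports.

Local Open Scope classical_set_scope.
Local Open Scope ring_scope.

Definition bounded_op {R : realType} {U W : normedModType R} (f : U -> W) :=
  exists C : R, forall u, `|f u| <= C * `|u|.

(** * The normed dual [Z'] of a normed space [Z] *)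

Section Dual.
Context {R : realType} (Z : normedModType R).

Definition dual_pred : {pred Z -> R^o} :=
  fun phi => `[< linear phi /\ bounded_op phi >].

(* The duality pairing <phi, z>_Z is the application [phi z]. *)
Record dual := Dual { dual_fun :> Z -> R^o; _ : dual_fun \in dual_pred }.

HB.instance Definition _ := [isSub for dual_fun].
HB.instance Definition _ := [Choice of dual by <:].

Fact dual_submod_closed : submod_closed dual_pred.
Proof.
split=> [|a phi psi].
- apply/asboolP; split=> [k x y|].
    by rewrite /= scaler0 addr0.
  by exists 0 => u; rewrite /= normr0 mul0r.
- move=> /asboolP[phil [C phiC]] /asboolP[psil [D psiD]]; apply/asboolP; split.
    move=> k x y; rewrite !fctE /= phil psil !scalerDr !scalerA (mulrC a k).
    by rewrite -!addrA; congr +%R; rewrite addrCA.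
  exists (`|a| * C + D) => u; rewrite mulrDl -mulrA.
  apply: le_trans (ler_normD _ _) _; apply: lerD => //.
  by rewrite normrZ ler_wpM2l.
Qed.

HB.instance Definition _ :=
  GRing.isSubmodClosed.Build R (Z -> R^o) dual_pred dual_submod_closed.
HB.instance Definition _ := [SubChoice_isSubLmodule of dual by <:].

Definition dual_norm (phi : dual) : R :=
  sup [set `|phi z| | z in [set z | `|z| <= 1]].

Fact dualP (phi : dual) : linear phi /\ bounded_op phi.
Proof. by case: phi => f /= /asboolP. Qed.

Fact dual_has_sup (phi : dual) :
  has_sup [set `|phi z| | z in [set z | `|z| <= 1]].
Proof.
split; first by exists `|phi 0|, 0 => //=; rewrite normr0.
have [_ [C phiC]] := dualP phi.
exists `|C| => _ [z /= z1 <-]; apply: le_trans (phiC z) _.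
rewrite -[leRHS]mulr1; apply: le_trans (ler_norm _) _.
by rewrite normrM normr_id ler_wpM2l.
Qed.

Fact dual_norm_ub (phi : dual) z : `|z| <= 1 -> `|phi z| <= dual_norm phi.
Proof. by move=> z1; apply: sup_upper_bound; [exact: dual_has_sup|exists z]. Qed.

Fact dual_norm_le (phi : dual) (C : R) :
  (forall z, `|z| <= 1 -> `|phi z| <= C) -> dual_norm phi <= C.
Proof.
move=> phiC; apply: ge_sup; first by have [] := dual_has_sup phi.
by move=> _ [z /= z1 <-]; exact: phiC.
Qed.

Fact dual_norm_ge0 (phi : dual) : 0 <= dual_norm phi.
Proof.
by apply: le_trans (normr_ge0 (phi 0)) _; apply: dual_norm_ub; rewrite normr0.
Qed.

Fact dual_normD (phi psi : dual) :
  dual_norm (phi + psi) <= dual_norm phi + dual_norm psi.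
Proof.
apply: dual_norm_le => z z1.
apply: le_trans (ler_normD (phi z) (psi z)) _.
by apply: lerD; exact: dual_norm_ub.
Qed.

Fact dual_normZ (a : R) (phi : dual) :
  dual_norm (a *: phi) = `|a| * dual_norm phi.
Proof.
have le b (psi : dual) : dual_norm (b *: psi) <= `|b| * dual_norm psi.
  apply: dual_norm_le => z z1; rewrite (_ : (b *: psi) z = b *: psi z)//.
  by rewrite normrZ ler_wpM2l//; exact: dual_norm_ub.
apply/le_anti; rewrite le /=; have [->|a0] := eqVneq a 0.
  by rewrite normr0 mul0r dual_norm_ge0.
rewrite -ler_pdivlMl ?normr_gt0// -normfV.
by rewrite -{1}[phi]scale1r -(mulVf a0) -scalerA.
Qed.

Fact dual_norm0_eq0 (phi : dual) : dual_norm phi = 0 -> phi = 0.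
Proof.
move=> phi0; apply/val_inj/funext => z /=.
have [phil _] := dualP phi.
have phiZ k x : phi (k *: x) = k *: phi x.
  have p0 : phi 0 = 0.
    have := phil 1 0 0; rewrite !scale1r addr0 => /eqP.
    by rewrite -subr_eq subrr => /eqP <-.
  by have := phil k x 0; rewrite p0 !addr0.
have [->|z0] := eqVneq z 0; first by have := phiZ 0 0; rewrite !scale0r.
have := @dual_norm_ub phi (`|z|^-1 *: z).
rewrite phi0 normrZ normfV normr_id mulVf ?normr_eq0// lexx => /(_ isT).
rewrite phiZ normr_le0 scaler_eq0 invr_eq0 normr_eq0 (negbTE z0) /=.
by move/eqP.
Qed.

HB.instance Definition _ :=
  Lmodule_isNormed.Build R dual dual_normD dual_normZ dual_norm0_eq0.

End Dual.

(** * Hilbert spaces, reflexivity, subspaces *)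

(* With completeness supplied by [completeNormedModType], this says that [Z] is
   a real Hilbert space. *)
Definition norm_from_inner_product {R : realType} (Z : normedModType R) :=
  exists ip : {dot Z for idfun}, forall z : Z, ip z z = `|z| ^+ 2.

Definition reflexive_space {R : realType} (Z : normedModType R) :=
  forall F : dual (dual Z), exists z : Z, forall phi : dual Z, F phi = phi z.

Definition findim_subspace {R : realType} {Z : lmodType R} (S : set Z) :=
  exists (n : nat) (e : 'I_n -> Z),
    S = [set z | exists c : 'I_n -> R, z = \sum_i c i *: e i].

(** * Bochner spaces on the time interval *)

Section Bochner.
Context {R : realType} {Z : normedModType R}.
Notation mu := (@lebesgue_measure R).

Definition simple_fun (s : R -> Z) :=
  finite_set (range s) /\ forall z, measurable (s @^-1` [set z]).

Definition strongly_measurable (D : set R) (f : R -> Z) :=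
  exists s : nat -> R -> Z, (forall n, simple_fun (s n)) /\
    {ae mu, forall t, D t -> s n t @[n --> \oo] --> f t}.

Definition in_L2 (T : R) (f : R -> Z) :=
  strongly_measurable `]0, T[ f /\
  (\int[mu]_(t in `]0%R, T[) (`|f t| ^+ 2)%:E < +oo)%E.

Definition test_function (T : R) (p : R -> R) :=
  (forall n x, derivable (derive1n n p) x 1) /\
  exists a c, [/\ 0 < a, c < T & forall t, ~~ (a <= t <= c) -> p t = 0].

End Bochner.

(* The defining identity int g p' = - int g' p is an identity of Bochner
   integrals in [Z']; these commute with evaluation at [z], and elements of
   [Z'] are equal when they agree at every [z]. *)
Definition weak_derivative {R : realType} {Z : normedModType R} (T : R)
    (g g' : R -> dual Z) :=
  forall p, test_function T p -> forall z : Z,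
    Rintegral (@lebesgue_measure R) `]0, T[ (fun t => g t z * derive1 p t) =
    - Rintegral (@lebesgue_measure R) `]0, T[ (fun t => g' t z * p t).

(* An element of H^1(0,T;Z') is represented by its continuous representative on
   [0,T], which is what gives meaning to the point values g(t_n). *)
Definition in_H1 {R : realType} {Z : normedModType R} (T : R)
    (g : R -> dual Z) :=
  {within `[0, T], continuous g} /\ in_L2 T g /\
  exists g' : R -> dual Z, in_L2 T g' /\ weak_derivative T g g'.

(** * The mixed problem *)

Section Mixed.
Context {R : realType} {X Y M : normedModType R}.
Variables (iota : {linear X -> Y}) (Rop : {linear Y -> dual Y})
  (A : {linear X -> dual X}) (b : {bilinear X -> M -> R^o}).

Definition bounded_form_on (Xs : set X) (Ms : set M) :=
  exists C : R, forall v q, Xs v -> Ms q -> `|b v q| <= C * `|v| * `|q|.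

Definition inf_sup_on (Xs : set X) (Ms : set M) (beta : R) :=
  forall q, Ms q ->
    beta * `|q| <= sup [set b v q / `|v| | v in [set v | Xs v /\ v != 0]].

(* [kernel_on setT setT] is V and [kernel_on Xh Mh] is V_h. *)
Definition kernel_on (Xs : set X) (Ms : set M) : set X :=
  [set v | Xs v /\ forall q, Ms q -> b v q = 0].

Definition monotone_on (S : set X) :=
  forall v, S v -> 0 <= Rop (iota v) (iota v).

Definition R_selfadjoint_on (S : set X) :=
  forall v w, S v -> S w ->
    Rop (iota v) (iota w) = Rop (iota w) (iota v).

Definition A_selfadjoint_on (S : set X) :=
  forall v w, S v -> S w -> A v w = A w v.

Definition garding_on (S : set X) (gamma alpha : R) :=
  forall v, S v ->
    alpha * `|v| ^+ 2 <= A v v + gamma * Rop (iota v) (iota v).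

Definition dbar {Z : normedModType R} (dt : R) (theta : nat -> Z) (n : nat) :=
  dt^-1 *: (theta n - theta n.-1).

(* Only the indices n <= N of the sequences [u] and [lam] are relevant. *)
Definition discrete_solution (Xh : set X) (Mh : set M) (T : R) (N : nat)
    (f : R -> dual X) (g : R -> dual M) (u0h : X)
    (u : nat -> X) (lam : nat -> M) :=
  let dt := T / N%:R in
  [/\ u 0%N = u0h, lam 0%N = 0 &
      forall n, (1 <= n <= N)%N ->
      [/\ Xh (u n), Mh (lam n),
          forall v, Xh v ->
            Rop (iota (dbar dt u n)) (iota v) + b v (dbar dt lam n)
            + A (u n) v = f (n%:R * dt) v
        & forall q, Mh q -> b (u n) q = g (n%:R * dt) q]].

Definition discrete_well_posed (Xh : set X) (Mh : set M) (T : R) (N : nat)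
    (f : R -> dual X) (g : R -> dual M) (u0h : X) :=
  (exists u lam, discrete_solution Xh Mh T N f g u0h u lam) /\
  (forall u1 lam1 u2 lam2,
      discrete_solution Xh Mh T N f g u0h u1 lam1 ->
      discrete_solution Xh Mh T N f g u0h u2 lam2 ->
      forall n, (1 <= n <= N)%N -> u1 n = u2 n /\ lam1 n = lam2 n).

End Mixed.

(* Main.v *)
Require Import Defs.
From HB Require Import structures.
From mathcomp Require Import all_boot all_order all_algebra.
From mathcomp Require Import sesquilinear.
From mathcomp Require Import all_classical all_reals all_analysis.
From mathcomp Require Import ring lra.

Set Implicit Arguments.
Unset Strict Implicit.
Unset Printing Implicit Defensive.

Import Order.TTheory GRing.Theory Num.Theory.
Import numFieldNormedType.Exports.

Local Open Scope classical_set_scope.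
Local Open Scope ring_scope.

(** With [z = (u, lam)], and after multiplication by the time step [s], one step
    of the scheme is a single variational equation on [Xh `*` Mh] for the
    saddle-point form
      [saddle s z w = Rop u v + b v lam + b u q + s * A u v],  [w = (v, q)]
    (the embedding [iota] is left out here). On a finite-dimensional space a
    nondegenerate bilinear form represents each functional in exactly one way,
    so it is enough that [saddle s] be nondegenerate; induction on the step then
    gives the theorem.

    By the inf-sup condition, [saddle s] is nondegenerate as soon as
    [Rop v v + s * A v v] vanishes on the discrete kernel [V_h] only at [v = 0]
    ([saddle_nondegenerate]). At a zero [v] of this quadratic form, [s] times
    the Garding inequality reads
      [s * alphah * `|v| ^+ 2 <= (s * xih - 1) * Rop v v],
    which forces [v = 0] if [s = xih^-1], or if [s <= xih^-1] and [Rop] is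
    monotone on [V_h]; in the latter case [tau = xih^-1] will do.

    The standing assumptions make [Rop] monotone on the continuous kernel [V],
    which need not contain [V_h]. Without monotonicity on [V_h], small steps
    are reached from the one good value [s = xih^-1]: the Gram determinant of
    [saddle s] in a basis is a polynomial in [s] that is nonzero at [xih^-1],
    hence all small positive [s] avoid its roots ([pencil_nondegenerate]). *)

(** * Bilinear forms on a finite-dimensional subspace *)

Section FiniteDimensional.
Context {R : realType} {Z : lmodType R}.
Implicit Types (S : set Z) (B P Q : Z -> Z -> R^o).

Definition span_of n (e : 'I_n -> Z) : set Z :=
  [set z | exists c : 'I_n -> R, z = \sum_i c i *: e i].

Definition free_family n (e : 'I_n -> Z) :=
  forall c : 'I_n -> R, \sum_i c i *: e i = 0 -> forall i, c i = 0.

Definition bilinear_form B :=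
  (forall w, linear (B^~ w)) /\ (forall z, linear (B z)).

(** One-sided; on a finite-dimensional subspace the other side follows. *)
Definition nondegenerate_on S B :=
  forall z, S z -> (forall w, S w -> B z w = 0) -> z = 0.

Definition gram B n (e : 'I_n -> Z) : 'M[R]_n := \matrix_(i, j) B (e i) (e j).

Lemma linear_comb (f : Z -> R^o) n (c : 'I_n -> R) (e : 'I_n -> Z) :
  linear f -> f (\sum_i c i *: e i) = \sum_i c i * f (e i).
Proof.
move=> lf; pose mf := GRing.isLinear.Build R Z R^o *:%R f lf.
pose F : {linear Z -> R^o} := HB.pack f mf.
rewrite -[LHS]/(F _) linear_sum; apply: eq_bigr => i _.
by rewrite linearZ.
Qed.

Lemma span_gen n (e : 'I_n -> Z) i : span_of e (e i).
Proof.
exists (fun j => (j == i)%:R); rewrite (bigD1 i)//= eqxx scale1r big1 ?addr0//.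
by move=> j /negPf ->; rewrite scale0r.
Qed.

Lemma findim0 S : findim_subspace S -> S 0.
Proof.
move=> [n [e ->]]; exists (fun=> 0).
by rewrite big1// => i _; rewrite scale0r.
Qed.

Lemma findimB S x y : findim_subspace S -> S x -> S y -> S (x - y).
Proof.
move=> [n [e ->]] [c ->] [d ->]; exists (fun i => c i - d i).
by rewrite -sumrB; apply: eq_bigr => i _; rewrite scalerBl.
Qed.

(** A spanning family of least length is free: a nontrivial relation would
    express one of its members through the others. *)
Lemma findim_basis S : findim_subspace S ->
  exists n (e : 'I_n -> Z), free_family e /\ S = span_of e.
Proof.
move=> [n0 [e0 Se0]].
pose spanned n := `[< exists e : 'I_n -> Z, S = span_of e >].
have exn : exists n, spanned n by exists n0; apply/asboolP; exists e0.
case: (ex_minnP exn) => -[|n] /asboolP[e Se] minn; exists _, e; split => //.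
  by move=> c _ [].
move=> c ce0 k; apply: contrapT => /eqP ck0.
suff /minn : spanned n by rewrite ltnn.
apply/asboolP; exists (fun j => e (lift k j)).
have ek : e k = \sum_j (- (c k)^-1 * c (lift k j)) *: e (lift k j).
  move: ce0; rewrite (bigD1_ord k)//= => /eqP; rewrite addr_eq0 => /eqP ce.
  rewrite -[LHS]scale1r -(mulVf ck0) -scalerA ce scalerN -scaleNr scaler_sumr.
  by apply: eq_bigr => j _; rewrite scalerA.
rewrite Se; apply/seteqP; split=> z [d ->].
  exists (fun j => d k * (- (c k)^-1 * c (lift k j)) + d (lift k j)).
  rewrite (bigD1_ord k)//= [in LHS]ek scaler_sumr -big_split/=.
  by apply: eq_bigr => j _; rewrite scalerDl scalerA.
exists (fun i => if unlift k i is Some j then d j else 0).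
rewrite (bigD1_ord k)//= unlift_none scale0r add0r.
by apply: eq_bigr => j _; rewrite liftK.
Qed.

Lemma gram_mulmx B n (e : 'I_n -> Z) (c : 'rV[R]_n) j : bilinear_form B ->
  (c *m gram B e) 0 j = B (\sum_i c 0 i *: e i) (e j).
Proof.
move=> [Bl _]; rewrite (linear_comb _ _ (Bl (e j))) mxE.
by apply: eq_bigr => i _; rewrite mxE.
Qed.

Lemma gram_unitP B n (e : 'I_n -> Z) : bilinear_form B -> free_family e ->
  gram B e \in unitmx <-> nondegenerate_on (span_of e) B.
Proof.
move=> Bbil fe; rewrite unitmxE unitfE; split=> [det0 z [c ->] Bz0|ndeg].
  apply: contrapT => z0; move/negP: det0; apply; apply/det0P.
  exists (\row_i c i).
    apply: contra_notN z0 => /eqP/rowP r0; rewrite big1// => i _.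
    by have := r0 i; rewrite !mxE => ->; rewrite scale0r.
  apply/rowP => j; rewrite gram_mulmx// mxE.
  under eq_bigr do rewrite mxE.
  by apply: Bz0; exact: span_gen.
apply/det0P => -[c /negP c0 cG]; apply: c0; apply/eqP/rowP => i; rewrite mxE.
apply: (fe (fun i => c 0 i)); apply: ndeg; first by exists (fun i => c 0 i).
move=> _ [d ->]; rewrite (linear_comb _ _ (Bbil.2 _)) big1// => j _.
by rewrite -gram_mulmx// cG mxE mulr0.
Qed.

Lemma nondegenerate_solve S B (F : Z -> R^o) : findim_subspace S ->
  bilinear_form B -> linear F -> nondegenerate_on S B ->
  exists2 z, S z & forall w, S w -> B z w = F w.
Proof.
move=> /findim_basis[n [e [fe ->]]] Bbil lF ndeg.
have GU : gram B e \in unitmx by apply/gram_unitP.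
pose c := (\row_j F (e j)) *m invmx (gram B e).
exists (\sum_i c 0 i *: e i); first by exists (fun i => c 0 i).
move=> _ [d ->]; rewrite (linear_comb _ _ (Bbil.2 _)) (linear_comb _ _ lF).
by apply: eq_bigr => j _; rewrite -gram_mulmx// mulmxKV// mxE.
Qed.

(** Write [p = q * 'X ^+ m] with [q.[0] != 0]; by continuity [q] does not vanish
    near [0], so [0] is isolated among the roots of [p]. *)
Lemma poly_neq0_right (p : {poly R}) : p != 0 ->
  exists2 tau : R, 0 < tau & forall s, 0 < s -> s <= tau -> p.[s] != 0.
Proof.
move=> p0; have [m [q]] := multiplicity_XsubC p 0.
rewrite p0 /= => q0 ->; rewrite subr0.
have /nbhs_ballP[d /= d0 qd] : \forall x \near (0 : R), q.[x] != 0.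
  have := continuous_horner (p := q) (x := 0).
  by move=> /cvgr_neq0; apply.
exists (d / 2); first by rewrite divr_gt0.
move=> s s0 sd; rewrite hornerM hornerXn.
apply: mulf_neq0; last by rewrite expf_neq0// gt_eqF.
apply: qd; rewrite /ball/= sub0r normrN gtr0_norm//.
by apply: le_lt_trans sd _; rewrite ltr_pdivrMr// ltr_pMr// ltr1n.
Qed.

(** In a basis, the Gram determinant of [P + s Q] is a polynomial in [s]; it is
    not the zero polynomial since it does not vanish at [s0]. *)
Lemma pencil_nondegenerate S P Q (s0 : R) : findim_subspace S ->
  (forall s : R, bilinear_form (fun z w => P z w + s * Q z w)) ->
  nondegenerate_on S (fun z w => P z w + s0 * Q z w) ->
  exists2 tau : R, 0 < tau & forall s, 0 < s -> s <= tau ->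
    nondegenerate_on S (fun z w => P z w + s * Q z w).
Proof.
move=> /findim_basis[n [e [fe ->]]] bil ndeg0.
pose p : {poly R} :=
  \det (\matrix_(i, j) ((P (e i) (e j))%:P + 'X * (Q (e i) (e j))%:P)).
have pE s : p.[s] = \det (gram (fun z w => P z w + s * Q z w) e).
  rewrite -[LHS]/(horner_eval s p) -det_map_mx; congr (\det _).
  by apply/matrixP => i j; rewrite !mxE /= /horner_eval !hornerE.
have p0 : p != 0.
  apply/eqP => p0; have /gram_unitP : nondegenerate_on (span_of e) _ := ndeg0.
  by move=> /(_ (bil s0) fe); rewrite unitmxE -pE p0 horner0 unitr0.
have [tau tau0 ptau] := poly_neq0_right p0.
exists tau => // s s_gt0 stau; apply/(gram_unitP (bil s) fe).
by rewrite unitmxE -pE unitfE ptau.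
Qed.

End FiniteDimensional.

Lemma findim_setX (R : realType) (X M : lmodType R) (Xh : set X) (Mh : set M) :
  findim_subspace Xh -> findim_subspace Mh ->
  findim_subspace (Xh `*` Mh : set (X * M)%type).
Proof.
move=> [n [e ->]] [m [d ->]]; exists (n + m)%N.
pose k (i : 'I_(n + m)) : X * M := match fintype.split i with
  inl j => (e j, 0) | inr j => (0, d j) end.
have fstE p (F : 'I_p -> X * M) : (\sum_i F i).1 = \sum_i (F i).1.
  exact: (big_morph fst).
have sndE p (F : 'I_p -> X * M) : (\sum_i F i).2 = \sum_i (F i).2.
  exact: (big_morph snd).
have kl j : k (lshift m j) = (e j, 0) by rewrite /k (unsplitK (inl j)).
have kr j : k (rshift n j) = (0, d j) by rewrite /k (unsplitK (inr j)).
have sumE (c : 'I_(n + m) -> R) : \sum_i c i *: k i =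
    (\sum_i c (lshift m i) *: e i, \sum_j c (rshift n j) *: d j).
  rewrite [LHS]surjective_pairing fstE sndE !big_split_ord/=.
  congr pair.
    rewrite [X in _ + X]big1 ?addr0 => [|i _]; last by rewrite kr/= scaler0.
    by apply: eq_bigr => i _; rewrite kl.
  rewrite [X in X + _]big1 ?add0r => [|i _]; last by rewrite kl/= scaler0.
  by apply: eq_bigr => i _; rewrite kr.
exists k; apply/seteqP; split=> [[x q] [/= [c ->] [c' ->]]|z [c ->]].
  exists (fun i => match fintype.split i with inl j => c j | inr j => c' j end).
  rewrite sumE; congr pair; apply: eq_bigr => i _.
    by rewrite (unsplitK (inl i)).
  by rewrite (unsplitK (inr i)).
by rewrite sumE; split=> /=; [exists (c \o lshift m)|exists (c \o @rshift n m)].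
Qed.

(** * The saddle-point form of one time step *)

Section SaddlePoint.
Context {R : realType} {X Y M : normedModType R}.
Variables (iota : {linear X -> Y}) (Rop : {linear Y -> dual Y})
  (A : {linear X -> dual X}) (b : {bilinear X -> M -> R^o})
  (Xh : set X) (Mh : set M).
Hypotheses (Xhfin : findim_subspace Xh) (Mhfin : findim_subspace Mh).

(** Adding the two equations of a time step, multiplied by the step [s], gives
    one variational equation on the product space; the part with [s] is kept
    apart so that the form is affine in [s]. *)
Definition saddle_fixed (z w : X * M) : R^o :=
  Rop (iota z.1) (iota w.1) + b w.1 z.2 + b z.1 w.2.

Definition saddle (s : R) (z w : X * M) : R^o :=
  saddle_fixed z w + s * A z.1 w.1.

Lemma dual_linear (Z : normedModType R) (phi : dual Z) a x y :
  phi (a *: x + y) = a * phi x + phi y.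
Proof. by have [-> _] := dualP phi. Qed.

Lemma dual0 (Z : normedModType R) (phi : dual Z) : phi 0 = 0.
Proof.
have := dual_linear phi 1 0 0; rewrite scaler0 addr0 mul1r => /eqP.
by rewrite -subr_eq subrr => /eqP <-.
Qed.

Lemma to_dual_linear (U Z : normedModType R) (F : {linear U -> dual Z})
    a x y z :
  F (a *: x + y) z = a * F x z + F y z.
Proof. by rewrite linearP. Qed.

Lemma form_linearl a x y q : b (a *: x + y) q = a * b x q + b y q.
Proof. by rewrite linearPl. Qed.

Lemma form_linearr a x p q : b x (a *: p + q) = a * b x p + b x q.
Proof. by rewrite linearPr. Qed.

Lemma saddle_bilinear s : bilinear_form (saddle s).
Proof.
split=> w a x y; rewrite /saddle /saddle_fixed /= /GRing.scale/=.
  rewrite linearP !to_dual_linear form_linearl form_linearr.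
  by ring.
rewrite linearP !dual_linear form_linearl form_linearr.
by ring.
Qed.

Hypothesis inf_sup : exists2 beta : R, 0 < beta & inf_sup_on b Xh Mh beta.

(** Testing with [(0, q)] puts [u] in the discrete kernel, testing with [(u, 0)]
    then gives [u = 0] by definiteness, and what remains, [b v lam = 0] for all
    discrete [v], gives [lam = 0] by the inf-sup condition. *)
Lemma saddle_nondegenerate s :
  (forall v, kernel_on b Xh Mh v ->
     Rop (iota v) (iota v) + s * A v v = 0 -> v = 0) ->
  nondegenerate_on (Xh `*` Mh : set (X * M)%type) (saddle s).
Proof.
have [X0 M0] := (findim0 Xhfin, findim0 Mhfin).
move=> definite [u lam] [/= Xu Mlam] ker.
have Vu : kernel_on b Xh Mh u.
  split=> // q Mq; have := ker (0, q) (conj X0 Mq).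
  rewrite /saddle /saddle_fixed/=.
  by rewrite !linear0 linear0l !dual0 mulr0 !addr0 !add0r.
have u0 : u = 0.
  apply: definite => //; have := ker (u, 0) (conj Xu M0).
  rewrite /saddle /saddle_fixed/= linear0r addr0.
  by rewrite (Vu.2 lam Mlam) addr0.
rewrite u0; congr pair; have [beta beta0 /(_ lam Mlam)] := inf_sup.
have bv0 v : Xh v -> b v lam = 0.
  move=> Xv; have := ker (v, 0) (conj Xv M0).
  rewrite u0 /saddle /saddle_fixed/= !linear0.
  by rewrite add0r addr0 [_ * _](_ : _ = 0) ?addr0 // mulr0.
move=> lam_le; apply/normr0_eq0/le_anti; rewrite normr_ge0 andbT.
rewrite -(pmulr_rle0 _ beta0); apply: le_trans lam_le _.
(* If [Xh] is trivial, the supremum is that of the empty set, which is [0]. *)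
set E := [set _ | _ in _]; have [->|/set0P E0] := eqVneq E set0.
  by rewrite sup0.
by apply: ge_sup => // _ [v [Xv _] <-]; rewrite bv0// mul0r.
Qed.

(** * Time stepping *)

(** Data [phi] and [psi] of one step, with previous values [z'], as a functional
    on the product space; the time difference quotient is cleared of its
    denominator [s]. *)
Definition step_rhs (s : R) (phi : dual X) (psi : dual M) (z' w : X * M) :
    R^o :=
  s * phi w.1 + Rop (iota z'.1) (iota w.1) + b w.1 z'.2 + psi w.2.

Lemma step_rhs_linear s phi psi z' : linear (step_rhs s phi psi z').
Proof.
move=> a x y; rewrite /step_rhs /= /GRing.scale/=.
by rewrite linearP !dual_linear form_linearl; ring.
Qed.

(** One direction adds the two equations of the step, the other one tests with
    [(v, 0)] and [(0, q)]. *)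
Lemma step_saddleP s (phi : dual X) (psi : dual M) u lam u' lam' : s != 0 ->
  ((forall v, Xh v ->
      Rop (iota (s^-1 *: (u - u'))) (iota v) + b v (s^-1 *: (lam - lam'))
      + A u v = phi v) /\
   (forall q, Mh q -> b u q = psi q)) <->
  (forall w, (Xh `*` Mh) w ->
     saddle s (u, lam) w = step_rhs s phi psi (u', lam') w).
Proof.
have [X0 M0] := (findim0 Xhfin, findim0 Mhfin).
have RopE v : Rop (iota (s^-1 *: (u - u'))) (iota v) =
    s^-1 * (Rop (iota u) (iota v) - Rop (iota u') (iota v)).
  by rewrite linearZ linearZ/= linearB linearB.
have bE v : b v (s^-1 *: (lam - lam')) = s^-1 * (b v lam - b v lam').
  by rewrite linearZr/= linearBr.
move=> s0; split=> [[eqX eqM] [v q] [/= Xv Mq]|eqw].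
  rewrite /saddle /saddle_fixed /step_rhs/= -eqX// eqM// RopE bE.
  by field.
split=> [v Xv|q Mq].
  have := eqw (v, 0) (conj Xv M0).
  rewrite /saddle /saddle_fixed /step_rhs/= linear0r dual0 !addr0 RopE bE => e.
  apply: (mulfI s0); apply: (addIr (Rop (iota u') (iota v) + b v lam')).
  rewrite [RHS]addrA -e.
  by field.
have := eqw (0, q) (conj X0 Mq).
rewrite /saddle /saddle_fixed /step_rhs/= !linear0 !linear0l !dual0.
by rewrite !mulr0 !addr0 !add0r.
Qed.

(** The solution is built step by step; two solutions that agree at step [n]
    solve the same equation at step [n.+1], so the form annihilates their
    difference there. *)
Lemma discrete_well_posed_nondegenerate (T : R) (N : nat) (f : R -> dual X)
    (g : R -> dual M) (u0h : X) :
  T / N%:R != 0 ->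
  nondegenerate_on (Xh `*` Mh : set (X * M)%type) (saddle (T / N%:R)) ->
  discrete_well_posed iota Rop A b Xh Mh T N f g u0h.
Proof.
set s := T / N%:R => s0 ndeg.
have XMfin := findim_setX Xhfin Mhfin.
pose rhs n := step_rhs s (f (n%:R * s)) (g (n%:R * s)).
split.
  have step n z' : exists z, (Xh `*` Mh) z /\
      forall w, (Xh `*` Mh) w -> saddle s z w = rhs n z' w.
    have [z Sz ez] := nondegenerate_solve XMfin (saddle_bilinear s)
      (step_rhs_linear s (f (n%:R * s)) (g (n%:R * s)) z') ndeg.
    by exists z.
  have /choice[next nextP] : forall nz : nat * (X * M), exists z,
      (Xh `*` Mh) z /\
      forall w, (Xh `*` Mh) w -> saddle s z w = rhs nz.1 nz.2 w.
    by case=> n z'; exact: step.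
  pose sol := fix sol n := if n is k.+1 then next (n, sol k) else (u0h, 0 : M).
  exists (fun n => (sol n).1), (fun n => (sol n).2); split=> // -[//|n] _.
  have [[Xu Ml] eqn] := nextP (n.+1, sol n).
  have [|eqX eqM] := (@step_saddleP s (f (n.+1%:R * s)) (g (n.+1%:R * s))
    (sol n.+1).1 (sol n.+1).2 (sol n).1 (sol n).2 s0).2.
    by move=> w Sw; rewrite -!surjective_pairing; exact: eqn.
  by split.
move=> u1 lam1 u2 lam2 [u10 lam10 sol1] [u20 lam20 sol2].
suff eq n : (n <= N)%N -> u1 n = u2 n /\ lam1 n = lam2 n.
  by move=> n /andP[_ /eq].
elim: n => [_|n IH nN]; first by rewrite u10 u20 lam10 lam20.
have [equ eql] := IH (ltnW nN).
have [Xu1 Ml1 eqX1 eqM1] := sol1 n.+1 nN.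
have [Xu2 Ml2 eqX2 eqM2] := sol2 n.+1 nN.
have eq1 := (step_saddleP _ _ _ _ _ _ s0).1 (conj eqX1 eqM1).
have eq2 := (step_saddleP _ _ _ _ _ _ s0).1 (conj eqX2 eqM2).
have : (u1 n.+1, lam1 n.+1) - (u2 n.+1, lam2 n.+1) = 0.
  apply: ndeg => [|w Sw]; first exact: findimB.
  have [/(_ w) saddlel _] := saddle_bilinear s.
  rewrite addrC -scaleN1r saddlel eq1// eq2//= equ eql.
  by rewrite scaleN1r addNr.
by move/eqP; rewrite subr_eq0 => /eqP[-> ->].
Qed.

End SaddlePoint.

Theorem mainTheorem1 (R : realType) (X Y M : completeNormedModType R)
    (iota : {linear X -> Y}) (Rop : {linear Y -> dual Y})
    (A : {linear X -> dual X}) (b : {bilinear X -> M -> R^o})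
    (beta gamma alpha : R)
    (Xh : set X) (Mh : set M) (xih alphah betah : R) :
  norm_from_inner_product X -> norm_from_inner_product Y ->
  reflexive_space M ->
  injective iota -> continuous iota -> dense (range iota) ->
  bounded_op Rop -> bounded_op A -> bounded_form_on b setT setT ->
  0 < beta -> inf_sup_on b setT setT beta ->
  R_selfadjoint_on iota Rop (kernel_on b setT setT) ->
  monotone_on iota Rop (kernel_on b setT setT) ->
  A_selfadjoint_on A (kernel_on b setT setT) ->
  0 < gamma -> 0 < alpha ->
  garding_on iota Rop A (kernel_on b setT setT) gamma alpha ->
  findim_subspace Xh -> findim_subspace Mh ->
  (* (i) *)
  0 < xih -> 0 < alphah ->
  garding_on iota Rop A (kernel_on b Xh Mh) xih alphah ->
  (* (ii) *)
  bounded_form_on b Xh Mh ->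
  0 < betah -> inf_sup_on b Xh Mh betah ->
  (* for all sufficiently small time steps; when R is monotone on V_h, every
     time step with xi_h * dt <= 1 is small enough *)
  exists tau : R,
    [/\ 0 < tau,
        monotone_on iota Rop (kernel_on b Xh Mh) -> xih^-1 <= tau
      & forall (T : R) (N : nat) (f : R -> dual X) (g : R -> dual M)
          (u0 : Y) (u0h : X),
          0 < T -> (0 < N)%N -> T / N%:R <= tau ->
          in_L2 T f -> in_H1 T g ->
          closure (iota @` kernel_on b setT setT) u0 -> Xh u0h ->
          discrete_well_posed iota Rop A b Xh Mh T N f g u0h].
Proof.
move=> _ _ _ _ _ _ _ _ _ _ _ _ _ _ _ _ _ Xhfin Mhfin xi0 alpha0 garding _.
move=> beta0 inf_sup.
have infsup : exists2 beta : R, 0 < beta & inf_sup_on b Xh Mh beta.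
  by exists betah.
(* The hypothesis [eq0] turns [s * A v v] into [- R v v] in [s] times the
   Garding inequality. *)
have definite s v : 0 < s -> kernel_on b Xh Mh v ->
    (s * xih - 1) * Rop (iota v) (iota v) <= 0 ->
    Rop (iota v) (iota v) + s * A v v = 0 -> v = 0.
  move=> s0 Vv le0 eq0; have := garding v Vv.
  rewrite -(ler_pM2l s0) mulrDr => gv.
  have {}gv : s * alphah * `|v| ^+ 2 <= 0 by lra.
  apply/normr0_eq0/eqP; rewrite -sqrf_eq0; apply/eqP/le_anti.
  by rewrite sqr_ge0 andbT -(pmulr_rle0 _ (mulr_gt0 s0 alpha0)).
have xiV0 : 0 < xih^-1 by rewrite invr_gt0.
have ndeg0 : nondegenerate_on (Xh `*` Mh : set (X * M)%type)
    (saddle iota Rop A b xih^-1).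
  apply: saddle_nondegenerate => // v Vv; apply: definite => //.
  by rewrite mulVf ?gt_eqF// subrr mul0r.
have [Rmon|Rnmon] := pselect (monotone_on iota Rop (kernel_on b Xh Mh)).
  exists xih^-1; split=> // T N f g u0 u0h T0 N0 dt_le _ _ _ _.
  have dt0 : 0 < T / N%:R by rewrite divr_gt0// ltr0n.
  apply: discrete_well_posed_nondegenerate => //; first by rewrite gt_eqF.
  apply: saddle_nondegenerate => // v Vv; apply: definite => //.
  rewrite mulr_le0_ge0//; last exact: Rmon.
  by rewrite subr_le0 -ler_pdivlMr// div1r.
have [tau tau0 ndeg] := pencil_nondegenerate (findim_setX Xhfin Mhfin)
  (saddle_bilinear iota Rop A b) ndeg0.
exists tau; split=> // T N f g u0 u0h T0 N0 dt_le _ _ _ _.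
have dt0 : 0 < T / N%:R by rewrite divr_gt0// ltr0n.
apply: discrete_well_posed_nondegenerate => //; first by rewrite gt_eqF.
exact: ndeg.
Qed.
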